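(* For any prime $p\ge 5$, \[ \sum_{k=0}^{p-1}(4k+3)\gamma_k \equiv 3\left(\frac{-3}{p}\right)p\pmod{p^3}. \]
   Context: For $n\ge 0$, the Almkvist--Zudilin numbers are \[ \gamma_n=\sum_{j=0}^{n}(-1)^{n-j}\frac{3^{n-3j}(3j)!}{(j!)^3}\binom{n}{3j}\binom{n+j}{j}. \] $\left(\frac{\cdot}{p}\right)$ denotes the Legendre symbol. *)

(* Defs.v *)
From HB Require Import structures.
From mathcomp Require Import all_boot all_order all_algebra.

Set Implicit Arguments.
Unset Strict Implicit.
Unset Printing Implicit Defensive.

Import GRing.Theory.

Local Open Scope ring_scope.

(* Almkvist-Zudilin numbers.  The natural-number subtraction in [n - 3 * j] is
   truncated only when n < 3 * j, in which case the factor 'C(n, 3 * j) is 0.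
   The division is exact: (3j)! / (j!)^3 is a multinomial coefficient. *)
Definition AZ (n : nat) : int :=
  \sum_(0 <= j < n.+1)
    (-1) ^+ (n - j) *
    (3 ^ (n - 3 * j) * ((3 * j)`! %/ (j`!) ^ 3) * 'C(n, 3 * j) * 'C(n + j, j))%N%:Z.

(* Legendre symbol (a / p), meaningful for p an odd prime; it is enough to look
   for a square root of a among the residues 0, ..., p - 1. *)
Definition legendre (a : int) (p : nat) : int :=
  if (p%:Z %| a)%Z then 0
  else if [exists x : 'I_p, ((x%:Z ^+ 2 == a %[mod p%:Z])%Z)] then 1
  else -1.

(* Main.v *)
Require Import Defs.
From mathcomp Require Import all_boot all_order all_algebra.
From mathcomp Require Import all_field ring zify.
Import GRing.Theory.

(* Write c(n, j) for the j-th summand of AZ n.  Summing over n first, (4n + 3) c(n, j) telescopes as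
   F(n, j) - F(n + 1, j) with F(n, j) = (n - 3j) c(n, j), and up to sign and powers of 3,
   (j!)^4 F(p, j) is p * prod_{i <= j} (p + i) * prod_{i <= 3j} (p - i).
   Let p = 3n + e with e = 1 or 2.  Since
     (p + i)(3i - p)(3i - 2p) = 9 i^3  (mod p^2),
   multiplying by prod_{i <= n} (3i - 2p) turns the sum of the F(p, j) modulo p^3 into a
   Chu-Vandermonde sum, with value (-3)^n n! up to the factor 3^p p.  The remaining congruence
     3^(p-1) prod_{i <= n} 3i = prod_{i <= n} (3i - 2p)  (mod p^2)
   follows by comparing (p-1)! with prod_{0 < i < p} 3i, reducing each 3i into (0, p).
   Finally (-1)^n = (-3/p), since -3 is a square mod p iff p has a primitive cube root of unity. *)

Local Open Scope ring_scope.

(** * Telescoping over n *)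

Definition AZ_term (n j : nat) : int :=
  (-1) ^+ (n - j) *
  (3 ^ (n - 3 * j) * ((3 * j)`! %/ (j`!) ^ 3) * 'C(n, 3 * j) * 'C(n + j, j))%N%:Z.

Lemma AZ_term_small (n j : nat) : (n < 3 * j)%N -> AZ_term n j = 0.
Proof. by move=> lt_n; rewrite /AZ_term bin_small // muln0 mul0n mulr0. Qed.

(** The ratio of consecutive terms gives (n + 1 - 3j) c(n + 1, j) = -3 (n + 1 + j) c(n, j), and 4n +
    3 = (n - 3j) + 3 (n + 1 + j). *)
Lemma AZ_term_step (n j : nat) :
  (4 * n + 3)%N%:Z * AZ_term n j =
  (n - 3 * j)%N%:Z * AZ_term n j - (n.+1 - 3 * j)%N%:Z * AZ_term n.+1 j.
Proof.
have [lt_n|le_n] := ltnP n (3 * j).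
  rewrite (AZ_term_small _ _ lt_n) (_ : n.+1 - 3 * j = 0)%N; last by lia.
  by rewrite !mulr0 mul0r subr0.
have step : ((n.+1 - 3 * j) * ('C(n.+1, 3 * j) * 'C(n.+1 + j, j)) =
             (n.+1 + j) * ('C(n, 3 * j) * 'C(n + j, j)))%N.
  have H2 := mul_bin_down n.+1 (3 * j).
  have H3 : ((n.+1 + j) * 'C(n + j, j) = n.+1 * 'C(n.+1 + j, j))%N.
    by have := mul_bin_down (n.+1 + j) j; rewrite addnK addSn.
  by rewrite /= in H2; rewrite mulnA -H2 mulnAC -H3; ring.
rewrite /AZ_term !subSn; [|lia|lia].
move: step; rewrite subSn // exprS (expnS 3).
set M := (_ %/ _)%N; move: ('C(n.+1, _)) ('C(n, _)) ('C(n.+1 + _, _)) ('C(n + _, _)) => a b c d.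
set s := _ ^+ _; set t := (3 ^ _)%N => step.
have {step} step : (n - 3 * j).+1%:Z * (a%:Z * c%:Z) = (n.+1 + j)%N%:Z * (b%:Z * d%:Z).
  by rewrite -!PoszM step.
rewrite !PoszM.
transitivity (s * t%:Z * M%:Z * ((n - 3 * j)%N%:Z * (b%:Z * d%:Z) + 3 * ((n.+1 + j)%N%:Z * (b%:Z * d%:Z)))).
  have -> : (4 * n + 3)%N%:Z = (n - 3 * j)%N%:Z + 3 * (n.+1 + j)%N%:Z by lia.
  ring.
rewrite -step; ring.
Qed.

Lemma sum_AZ (p : nat) :
  \sum_(0 <= k < p) (4 * k + 3)%N%:Z * AZ k =
  - \sum_(0 <= j < p) (p - 3 * j)%N%:Z * AZ_term p j.
Proof.
transitivity (\sum_(0 <= k < p) \sum_(0 <= j < p) (4 * k + 3)%N%:Z * AZ_term k j).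
  rewrite big_nat [RHS]big_nat; apply: eq_bigr => k /andP[_ lt_kp].
  rewrite /AZ big_distrr /= (big_cat_nat (leq0n k.+1) lt_kp) /=.
  rewrite [X in _ + X]big_nat_cond [X in _ + X]big1 ?addr0 // => j.
  by rewrite andbT => /andP[lt_kj _]; rewrite AZ_term_small ?mulr0 //; lia.
rewrite exchange_big_nat -sumrN; apply: eq_bigr => j _ /=.
under eq_bigr => k _ do rewrite AZ_term_step -opprB.
(* At n = 0 the truncated [0 - 3 * j] is 0, so only the end n = p survives. *)
by rewrite sumrN telescope_sumr // sub0n mul0r subr0.
Qed.

(** * The Chu-Vandermonde identity *)

(** Division-free form of 2F1(-n, b; c; 1) = (c - b)_n / (c)_n, with rising factorials of step [h].
    In the induction, Pascal's rule splits the sum: the ['C(n, j)] half is c + hn times the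
    hypothesis at b, c, and the other half is -b times the hypothesis at b + h, c + h, where c - b
    is unchanged. *)
Lemma chu_vandermonde (R : comNzRingType) (h b c : R) (n : nat) :
  \sum_(0 <= j < n.+1) (-1) ^+ j * 'C(n, j)%:R * \prod_(0 <= i < j) (b + h *+ i)
     * \prod_(j <= i < n) (c + h *+ i) =
  \prod_(0 <= i < n) (c - b + h *+ i).
Proof.
elim: n b c => [|n IH] b c; first by rewrite big_nat1 !big_geq // !mulr1.
rewrite (big_nat_recl n.+1) // bin0.
under [X in _ + X = _]eq_bigr => j _ do rewrite binS natrD mulrDr !mulrDl.
rewrite big_split /= addrA.
have -> : \sum_(0 <= i < n.+1) (-1) ^+ i.+1 * 'C(n, i)%:R *
    \prod_(0 <= i0 < i.+1) (b + h *+ i0) * \prod_(i.+1 <= i0 < n.+1) (c + h *+ i0) =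
   - b * \prod_(0 <= i < n) (c - b + h *+ i).
  have := IH (b + h) (c + h).
  rewrite (_ : c + h - (b + h) = c - b); last by ring.
  move=> <-; rewrite big_distrr; apply: eq_bigr => j _ /=.
  rewrite big_nat_recl // mulr0n addr0 big_add1 /= exprS.
  under eq_bigr => i _ do rewrite mulrS addrA.
  under [X in _ * X = _]eq_bigr => i _ do rewrite mulrS addrA.
  ring.
rewrite [X in _ + X + _ = _]big_nat_recr //= bin_small // mulr0 !mul0r addr0.
rewrite -[X in X + _ + _ = _]/((-1) ^+ 0 * 1%:R * _ * _).
have -> : (-1) ^+ 0 * 1%:R * \prod_(0 <= i < 0) (b + h *+ i) * \prod_(0 <= i < n.+1) (c + h *+ i) +
   \sum_(0 <= i < n) (-1) ^+ i.+1 * 'C(n, i.+1)%:R * \prod_(0 <= i0 < i.+1) (b + h *+ i0) *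
   \prod_(i.+1 <= i0 < n.+1) (c + h *+ i0) =
   (c + h *+ n) * \prod_(0 <= i < n) (c - b + h *+ i).
  rewrite -IH -[in 1%:R](bin0 n) -(big_nat_recl n 0 (fun j => (-1) ^+ j * 'C(n, j)%:R *
     \prod_(0 <= i0 < j) (b + h *+ i0) * \prod_(j <= i0 < n.+1) (c + h *+ i0))) //.
  rewrite big_distrr big_nat [RHS]big_nat; apply: eq_bigr => j /andP[_ le_jn] /=.
  by rewrite (big_nat_recr n) //=; ring.
rewrite [RHS]big_nat_recr //=; ring.
Qed.

(** * Congruences between products of integers *)

Lemma eqz_modP (m x y : int) : (x = y %[mod m])%Z <-> (m %| x - y)%Z.
Proof. by rewrite -eqz_mod_dvd; split=> [->|/eqP]. Qed.

Lemma eqz_modM (m x y z t : int) :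
  (x = y %[mod m])%Z -> (z = t %[mod m])%Z -> (x * z = y * t %[mod m])%Z.
Proof. by move=> xy zt; rewrite -modzMm xy zt modzMm. Qed.

Lemma eqz_mod_mul2l (m w x y : int) : coprimez m w ->
  (w * x = w * y %[mod m])%Z -> (x = y %[mod m])%Z.
Proof. by move=> co /eqz_modP; rewrite -mulrBr Gauss_dvdzr // => /eqz_modP. Qed.

Lemma eqz_mod_prod (m : int) (a b : nat) (F G : nat -> int) :
  (forall i, (a <= i < b)%N -> (F i = G i %[mod m])%Z) ->
  (\prod_(a <= i < b) F i = \prod_(a <= i < b) G i %[mod m])%Z.
Proof.
move=> FG; rewrite big_nat_cond [in RHS]big_nat_cond.
apply: (big_ind2 (fun x y => (x = y %[mod m])%Z)) => //.
  by move=> *; apply: eqz_modM.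
by move=> i /andP[/FG].
Qed.

Lemma coprimez_prod (m : int) (a b : nat) (F : nat -> int) :
  (forall i, (a <= i < b)%N -> coprimez m (F i)) ->
  coprimez m (\prod_(a <= i < b) F i).
Proof.
move=> coF; rewrite big_nat_cond.
apply: (big_ind (fun x => coprimez m x)); first by rewrite coprimezE coprimen1.
  by move=> x y cox coy; rewrite coprimezMr cox.
by move=> i /andP[/coF].
Qed.

Lemma coprimez_small (p i : nat) : prime p -> (0 < i < p)%N -> coprimez p i.
Proof.
move=> p_pr ip; rewrite coprimezE prime_coprime //=.
by apply/negP => /dvdn_leq; lia.
Qed.

Lemma coprimez_shift (p i : nat) (k : int) : prime p -> (5 <= p)%N ->
  (0 < i < p)%N -> coprimez p ((3 * i)%N%:Z - k * p%:Z).
Proof.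
move=> p_pr p5 ip; have: coprimez p (3 * i)%N%:Z.
  by rewrite PoszM coprimezMr !coprimez_small // ; lia.
by rewrite /coprimez -(gcdzMDl (- k)) mulNr addrC.
Qed.

(** * Products over residue classes modulo 3 *)

(** Factors are grouped in threes; naming the classes e, 3 - e and 0 lets p = 1 and p = 2 (mod 3) be
    treated together. *)
Lemma prod_residues (R : comNzRingType) (x : R) (e j : nat) :
  (e == 1)%N || (e == 2)%N ->
  \prod_(0 <= m < 3 * j) (x + m.+1%:R) =
  \prod_(0 <= i < j)
    ((x + (3 * i + e)%N%:R) * (x + (3 * i + (3 - e))%N%:R) * (x + (3 * i.+1)%N%:R)).
Proof.
move=> he; elim: j => [|j IH]; first by rewrite !big_geq.
rewrite [RHS]big_nat_recr // -IH mulnSr addnS addnS addn1 !big_nat_recr //= -!mulrA.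
congr (_ * _).
by case/orP: he => /eqP ->; rewrite addn1 addn2 // mulrCA.
Qed.

Section Residues.
Variables (p n e : nat).
Hypotheses (p_pr : prime p) (p5 : (5 <= p)%N).
Hypotheses (pE : p = (3 * n + e)%N) (he : (e == 1)%N || (e == 2)%N).

(** This range of [i] is p < 3i < 2p, so in [V] each 3i is replaced by its residue in (0, p). *)
Let U := \prod_(n.+1 <= i < p - n) (3 * i)%N%:Z.
Let V := \prod_(n.+1 <= i < p - n) ((3 * i)%N%:Z - p%:Z).

Lemma mid_prod : (U = V %[mod p%:Z ^+ 2])%Z.
Proof.
(* Reversing i -> p - i in one copy, 3i (3p - 3i) = (3i - p)(2p - 3i) (mod p^2). *)
have UU : (U * U = V * V %[mod p%:Z ^+ 2])%Z.
  rewrite /U /V {2}big_nat_rev [X in (_ = _ * X %[mod _])%Z]big_nat_rev -!big_split /=.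
  apply: eqz_mod_prod => i ip; apply/eqz_modP.
  rewrite (_ : 3 * (n.+1 + (p - n) - i.+1) = 3 * p - 3 * i)%N; last by lia.
  rewrite -subzn; last by lia.
  rewrite !PoszM; apply/dvdzP; exists 2; ring.
have UV : (U = V %[mod p%:Z])%Z.
  apply: eqz_mod_prod => i _; apply/eqz_modP.
  by rewrite opprB addrC subrK dvdzz.
(* U + V = 2U (mod p) is a unit, so it cancels from (U + V)(U - V) = 0 (mod p^2). *)
have coU : coprimez p (U + V).
  rewrite /coprimez -gcdz_modr -modzDmr -UV modzDmr gcdz_modr -/(coprimez _ _).
  rewrite -mulr2n -mulr_natl coprimezMr coprimez_prod /= => [|i ip].
    by rewrite andbT coprimez_small //; lia.
  by have := @coprimez_shift p i 0 p_pr p5; rewrite mul0r subr0; apply; lia.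
apply: (@eqz_mod_mul2l _ (U + V)); first by rewrite coprimezXl.
apply/eqz_modP; move/eqz_modP: UU.
by congr (_ %| _)%Z; ring.
Qed.

(* The three products run over the residues 0, -e and e modulo 3. *)
Lemma fact_split :
  (p.-1)`!%:Z = \prod_(0 <= i < n) (3 * i.+1)%N%:Z * V *
     \prod_(0 <= i < n) (p%:Z - (3 * i.+1)%N%:Z).
Proof.
have -> : (p.-1)`!%:Z = \prod_(0 <= m < p.-1) m.+1%:R :> int.
  by rewrite fact_prod big_add1 -natz natr_prod.
have := @prod_residues int 0 e n he; under eq_bigr do rewrite add0r.
under [RHS]eq_bigr do rewrite !add0r !natz.
move=> H.
have -> : \prod_(0 <= i < n) (p%:Z - (3 * i.+1)%N%:Z) = \prod_(0 <= i < n) (3 * i + e)%N%:Z.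
  by rewrite big_nat_rev big_nat [RHS]big_nat; apply: eq_bigr => i ip; lia.
have -> : V = \prod_(0 <= i < n + e.-1) (3 * i + (3 - e))%N%:Z.
  rewrite /V -{1}[n.+1]add0n big_addn.
  rewrite (_ : p - n - n.+1 = n + e.-1)%N; last by lia.
  apply: eq_bigr => i _; lia.
rewrite !big_split /= in H.
(* For e = 1 the triples exhaust the p - 1 = 3n factors; for e = 2 the factor 3n + 1 is left over,
   and it is the last one of [V]. *)
case/orP: he => /eqP E; move: H; rewrite pE E.
  rewrite addn1 addn0 /= => ->; ring.
rewrite addn2 addn1 /= !big_nat_recr //= => ->; rewrite natz [in RHS](addn1 (3 * n)); ring.
Qed.

Lemma pow3_prod :
  (3 ^+ p.-1 * \prod_(0 <= i < n) (3 * i.+1)%N%:Z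
   = \prod_(0 <= i < n) ((3 * i.+1)%N%:Z - 2 * p%:Z) %[mod p%:Z ^+ 2])%Z.
Proof.
have prod_opp (F G : nat -> int) : (forall i, F i = - G i) ->
    \prod_(0 <= i < n) F i = (-1) ^+ n * \prod_(0 <= i < n) G i.
  move=> FG; under eq_bigr => i _ do rewrite FG -mulN1r.
  by rewrite big_split /= prodr_const_nat subn0.
have facts := fact_split.
rewrite (prod_opp (fun i => p%:Z - (3 * i.+1)%N%:Z) (fun i => (3 * i.+1)%N%:Z - 1 * p%:Z)) in facts; last by move=> i; rewrite mul1r opprB.
have pow : 3 ^+ p.-1 * (p.-1)`!%:Z = \prod_(0 <= i < n) (3 * i.+1)%N%:Z * U *
     ((-1) ^+ n * \prod_(0 <= i < n) ((3 * i.+1)%N%:Z - 3 * p%:Z)).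
  rewrite -(prod_opp (fun i => 3 * p%:Z - (3 * i.+1)%N%:Z)); last by move=> i; rewrite opprB.
  have -> : 3 ^+ p.-1 * (p.-1)`!%:Z = \prod_(1 <= i < p) (3 * i)%N%:Z.
    rewrite fact_prod prednK; last by lia.
    under [RHS]eq_bigr do rewrite PoszM.
    rewrite big_split /= prodr_const_nat subn1 -natz natr_prod.
    by congr (_ * _); apply: eq_bigr => i _; rewrite natz.
  (* The three ranges are 3i < p, p < 3i < 2p and 2p < 3i; the last is reversed by i -> p - i. *)
  rewrite (@big_cat_nat _ _ _ n.+1) //=; last by lia.
  rewrite (@big_cat_nat _ _ _ (p - n) n.+1) //=; [|lia|lia].
  rewrite big_add1 /= mulrA; congr (_ * _ * _).
  rewrite big_nat_rev /= -{1}[(p - n)%N]add0n big_addn subKn; last by lia.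
  by rewrite big_nat [RHS]big_nat; apply: eq_bigr => i ip; lia.
have co k : coprimez (p%:Z ^+ 2) (\prod_(0 <= i < n) ((3 * i.+1)%N%:Z - k * p%:Z)).
  by rewrite coprimezXl // coprimez_prod // => i ip; rewrite coprimez_shift //; lia.
have co0 : coprimez (p%:Z ^+ 2) (\prod_(0 <= i < n) (3 * i.+1)%N%:Z).
  by have := co 0; under eq_bigr do rewrite mul0r subr0.
have coV : coprimez (p%:Z ^+ 2) V.
  rewrite coprimezXl // coprimez_prod // => i ip.
  by have := @coprimez_shift p i 1 p_pr p5; rewrite mul1r; apply; lia.
have cosgn : coprimez (p%:Z ^+ 2) ((-1) ^+ n).
  by rewrite coprimezXr // coprimezN coprimezE coprimen1.
move: pow facts co0 (co 1) (co 2) (co 3).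
(* With x = 3i, both x (x - 3p) and (x - p)(x - 2p) are x^2 - 3px modulo p^2. *)
have ad_bc : (\prod_(0 <= i < n) (3 * i.+1)%N%:Z * \prod_(0 <= i < n) ((3 * i.+1)%N%:Z - 3 * p%:Z)
   = \prod_(0 <= i < n) ((3 * i.+1)%N%:Z - 1 * p%:Z) * \prod_(0 <= i < n) ((3 * i.+1)%N%:Z - 2 * p%:Z)
    %[mod p%:Z ^+ 2])%Z.
  rewrite -!big_split /=; apply: eqz_mod_prod => i _.
  by apply/eqz_modP/dvdzP; exists (-2); ring.
move: ad_bc.
(* [a], [b], [c], [d] are the products of 3i, 3i - p, 3i - 2p, 3i - 3p. The two forms of 3^(p-1)
   (p-1)! give 3^(p-1) b = d, hence 3^(p-1) a d = 3^(p-1) b c = d c, and d cancels. *)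
set a := \prod_(_ <= _ < _) _; set d := \prod_(_ <= _ < _) _.
set b := \prod_(_ <= _ < _) _; set c := \prod_(_ <= _ < _) _.
move=> ad_bc pow facts coa cob coc cod.
have bd : (3 ^+ p.-1 * b = d %[mod p%:Z ^+ 2])%Z.
  apply: (@eqz_mod_mul2l _ (a * V * (-1) ^+ n)); first by rewrite !coprimezMr coa coV.
  have -> : a * V * (-1) ^+ n * (3 ^+ p.-1 * b) = 3 ^+ p.-1 * (p.-1)`!%:Z.
    by rewrite facts; ring.
  rewrite pow -!mulrA; apply: eqz_modM => //; apply: eqz_modM => //; exact: mid_prod.
apply: (@eqz_mod_mul2l _ d) => //.
transitivity ((3 ^+ p.-1 * b * c) %% p%:Z ^+ 2)%Z.
  rewrite mulrCA -mulrA; apply: eqz_modM => //.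
  by rewrite mulrC.
exact: eqz_modM.
Qed.
End Residues.

(** * The Legendre symbol of -3 *)

Lemma legendreN3_sqr (p : nat) : prime p -> (5 <= p)%N ->
  legendre (-3) p = if [exists x : 'F_p, x ^+ 2 == - 3%:R] then 1 else -1.
Proof.
move=> p_pr p5; rewrite /legendre.
have ch : p \in [pchar 'F_p] by exact: pchar_Fp.
rewrite ifF; last by rewrite /dvdz /=; apply/negP => /dvdn_leq; lia.
have sqrE (x : int) : (x ^+ 2 == -3 %[mod p%:Z])%Z = ((x%:~R : 'F_p) ^+ 2 == - 3%:R).
  rewrite eqz_mod_dvd (dvdz_pcharf ch) rmorphB rmorphXn /= subr_eq0.
  by congr (_ == _); rewrite rmorphN.
congr (if _ then _ else _); apply/existsP/existsP => -[x].
  by rewrite sqrE => x2; exists (x : int)%:~R.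
move=> x2; have xp : (x < p)%N by rewrite -[X in (_ < X)%N]Fp_cast.
by exists (Ordinal xp); rewrite sqrE /= -pmulrn natr_Zp.
Qed.

Lemma legendreN3 (p : nat) : prime p -> (5 <= p)%N ->
  legendre (-3) p = if (p %% 3 == 1)%N then 1 else -1.
Proof.
move=> p_pr p5; rewrite legendreN3_sqr //; congr (if _ then _ else _).
have nz k : (0 < k < p)%N -> k%:R != 0 :> 'F_p.
  by move=> kp; rewrite -(dvdn_pcharf (pchar_Fp p_pr)); apply/negP => /dvdn_leq; lia.
have n2 : 2%:R != 0 :> 'F_p by apply: nz; lia.
have n3 : 3%:R != 0 :> 'F_p by apply: nz; lia.
have p3 : (p %% 3 == 0)%N = false.
  by apply/negP; rewrite -/(dvdn 3 p) dvdn_prime2 //; lia.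
have fermat (x : 'F_p) : x != 0 -> x ^+ p.-1 = 1.
  move=> x0; apply: (mulfI x0); rewrite -exprS prednK; last by lia.
  by rewrite mulr1 -[X in _ ^+ X](card_Fp p_pr) expf_card.
apply/idP/idP => [/existsP[x /eqP x2]|p1].
  (* The root of w^2 + w + 1 by the quadratic formula, whose discriminant is -3. *)
  pose w : 'F_p := (x - 1) / 2%:R.
  have w2 : w ^+ 2 + w + 1 = 0.
    rewrite (_ : _ + 1 = (x ^+ 2 + 3%:R) / 4%:R); first by rewrite x2 addNr mul0r.
    have n4 : 4%:R != 0 :> 'F_p by apply: nz; lia.
    rewrite /w; field; rewrite ?n2 ?n4 //.
  have w3 : w ^+ 3 = 1.
    apply/eqP; rewrite -subr_eq0 (_ : _ - 1 = (w - 1) * (w ^+ 2 + w + 1)); last by ring.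
    by rewrite w2 mulr0.
  have w0 : w != 0.
    apply/negP => /eqP wz; move/eqP: w3.
    by rewrite wz expr0n eq_sym oner_eq0.
  have w1 : w != 1.
    apply: contra_eq_neq w2 => ->.
    by rewrite (_ : _ + 1 = 3%:R) //; ring.
  apply/negPn/negP => pn1.
  (* Here p = 2 (mod 3), so Fermat's theorem together with w^3 = 1 forces w = 1. *)
  have e : p.-1 = ((p %/ 3) * 3 + 1)%N by lia.
  by move: (fermat w w0); rewrite e exprD mulnC exprM w3 expr1n mul1r expr1 => /eqP; apply/negP.
pose n := (p %/ 3)%N.
(* X^n - 1 has at most n = (p - 1)/3 roots, fewer than the p - 1 nonzero elements; for a non-root g,
   the power g^n is a primitive cube root of unity. *)
have [g /andP[g0 gn]] : exists g : 'F_p, (g != 0) && (g ^+ n != 1).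
  apply/existsP; rewrite -[X in is_true X]negbK negb_exists; apply/negP => /forallP all1.
  have := @max_poly_roots _ ('X^n - 1 : {poly 'F_p}) [seq x <- enum 'F_p | x != 0].
  have s : size ('X^n - 1 : {poly 'F_p}) = n.+1 by rewrite size_XnsubC //; lia.
  rewrite -size_poly_eq0 s filter_uniq ?enum_uniq // => /(_ isT) H.
  have := H _ isT; rewrite size_filter.
  have -> : count (fun x : 'F_p => x != 0) (enum 'F_p) = p.-1.
    have := count_predC (pred1 (0 : 'F_p)) (enum 'F_p).
    rewrite -cardE card_Fp // count_uniq_mem ?enum_uniq // mem_enum => /(congr1 predn).
    exact.
  have -> : all (root ('X^n - 1)) [seq x <- enum 'F_p | x != 0].
    apply/allP => x; rewrite mem_filter => /andP[x0 _].
    have := all1 x; rewrite x0 negbK /= => /eqP xn.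
    by rewrite /root !hornerE xn subrr.
  by move=> /(_ isT); lia.
have w3 : (g ^+ n) ^+ 3 = 1.
  by rewrite -exprM (_ : (n * 3)%N = p.-1) ?fermat //; lia.
(* The inverse of the substitution w = (x - 1)/2. *)
apply/existsP; exists (2%:R * g ^+ n + 1); move: w3 gn; set w := g ^+ n => w3 gn.
have : (w - 1) * (w ^+ 2 + w + 1) == 0.
  by rewrite (_ : _ * _ = w ^+ 3 - 1); [rewrite w3 subrr|ring].
rewrite mulf_eq0 subr_eq0 (negPf gn) /= => /eqP w2.
rewrite -subr_eq0 (_ : _ - _ = 4%:R * (w ^+ 2 + w + 1)); last by ring.
by rewrite w2 mulr0.
Qed.

(** * The boundary terms at n = p, modulo p^3 *)

Lemma AZ_multinomial (j : nat) : ((3 * j)`! %/ j`! ^ 3 * j`! ^ 3 = (3 * j)`!)%N.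
Proof.
rewrite divnK //; apply/dvdnP; exists ('C(3 * j, j) * 'C(2 * j, j))%N.
rewrite -(@bin_fact (3 * j) j); last by lia.
rewrite (_ : 3 * j - j = 2 * j)%N; last by lia.
rewrite -(@bin_fact (2 * j) j); last by lia.
rewrite (_ : 2 * j - j = j)%N; last by lia.
ring.
Qed.

(** Three factors j! clear the multinomial denominator and the fourth that of ['C(p + j, j)]. The
    weight p - 3j turns C(p, 3j) (3j)! into p times a falling factorial of p - 1. *)
Lemma AZ_term_fact (p j : nat) : (3 * j < p)%N ->
  j`!%:Z ^+ 4 * ((p - 3 * j)%N%:Z * AZ_term p j) =
  (-1) ^+ (p - j) * 3 ^+ (p - 3 * j) * p%:Z *
  \prod_(0 <= i < 3 * j) (p%:Z - i.+1%:Z) * \prod_(0 <= i < j) (p%:Z + i.+1%:Z).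
Proof.
move=> lt_jp.
have -> : \prod_(0 <= i < 3 * j) (p%:Z - i.+1%:Z) = (p.-1 ^_ (3 * j))%:Z.
  rewrite ffact_prod big_mkord -[RHS]natz natr_prod; apply: eq_bigr => i _.
  by have := ltn_ord i; lia.
have -> : \prod_(0 <= i < j) (p%:Z + i.+1%:Z) = ((p + j) ^_ j)%:Z.
  rewrite ffact_prod big_nat_rev /= big_mkord -[RHS]natz natr_prod; apply: eq_bigr => i _.
  by have := ltn_ord i; lia.
have H1 : ((p - 3 * j) * ('C(p, 3 * j) * (3 * j)`!) = p * p.-1 ^_ (3 * j))%N.
  by rewrite bin_ffact mulnC -ffactnSr ffactnS.
rewrite -(bin_ffact (p + j) j) /AZ_term.
rewrite -AZ_multinomial in H1; move: H1; set M := (_ %/ _)%N => H1.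
have {}H1 : (p - 3 * j)%N%:Z * ('C(p, 3 * j)%:Z * (M%:Z * j`!%:Z ^+ 3)) = p%:Z * (p.-1 ^_ (3 * j))%:Z.
  by rewrite -PoszM -H1 !PoszM; ring.
rewrite !PoszM -[_ * p%:Z * _]mulrA -H1 -[(3 ^ _)%N%:Z]natz natrX; ring.
Qed.

(** Thanks to the explicit factor p of each term, the cofactors matter only modulo p^2. *)
Lemma eqz_mod_lift (p : nat) (x y : int) :
  (x = y %[mod p%:Z ^+ 2])%Z -> (p%:Z * x = p%:Z * y %[mod p%:Z ^+ 3])%Z.
Proof.
by move=> /eqz_modP xy; apply/eqz_modP; rewrite -mulrBr exprS dvdz_mul.
Qed.

Section Congruence.
Variables (p n e : nat).
Hypotheses (p_pr : prime p) (p5 : (5 <= p)%N).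
Hypotheses (pE : p = (3 * n + e)%N) (he : (e == 1)%N || (e == 2)%N).

(** Chu-Vandermonde parameters for step 3: c + 3i = 3(i + 1) - 2p, and c - b = e - p = -3n. *)
Let b : int := (3 - e)%N%:Z - p%:Z.
Let c : int := 3 - 2 * p%:Z.

Lemma sgn_sub (j : nat) : (j <= p)%N -> (-1) ^+ (p - j) = - (-1) ^+ j :> int.
Proof.
move=> le_jp; have p_odd : odd p by have [|] := even_prime p_pr; [lia|].
by rewrite -signr_odd oddB // p_odd addTb -[in RHS]signr_odd; case: (odd j).
Qed.

Lemma AZ_term_mod (j : nat) : (j <= n)%N ->
  (\prod_(0 <= i < j) (c + 3 *+ i) * - ((p - 3 * j)%N%:Z * AZ_term p j) =
   3 ^+ p * p%:Z * ((-1) ^+ j * 'C(n, j)%:R * \prod_(0 <= i < j) (b + 3 *+ i))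
   %[mod p%:Z ^+ 3])%Z.
Proof.
move=> le_jn; have lt_jp : (3 * j < p)%N by case/orP: he; lia.
have cof : coprimez (p%:Z ^+ 3) (j`!%:Z ^+ 4).
  rewrite coprimezXl // coprimezXr // fact_prod -[X in coprimez _ X]natz natr_prod.
  by apply: coprimez_prod => i ij; rewrite natz coprimez_small //; lia.
apply: (eqz_mod_mul2l _ _ _ _ cof).
rewrite mulrCA mulrN AZ_term_fact // sgn_sub; last by lia.
(* By residue class of m in p - m: class e gives the binomial, since 3i + e - p = -3(n - i); class
   -e gives the [b] product; class 0 gives the factors 3i - p. *)
have split : \prod_(0 <= i < 3 * j) (p%:Z - i.+1%:Z) =
    (-3) ^+ j * 'C(n, j)%:R * j`!%:Z * ((-1) ^+ j * \prod_(0 <= i < j) (b + 3 *+ i)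
    * \prod_(0 <= i < j) ((3 * i.+1)%N%:Z - p%:Z)).
  have -> : (-3) ^+ j * 'C(n, j)%:R * j`!%:Z = \prod_(0 <= i < j) (- p%:Z + (3 * i + e)%N%:Z).
    rewrite -mulrA (_ : 'C(n, j)%:R * j`!%:Z = \prod_(0 <= i < j) (n - i)%N%:Z); last first.
      rewrite natz -PoszM bin_ffact ffact_prod big_mkord -[LHS]natz natr_prod.
      by apply: eq_bigr => i _; rewrite natz.
    rewrite -[j in _ ^+ j]subn0 -prodr_const_nat -big_split big_nat [RHS]big_nat.
    by apply: eq_bigr => i ij /=; lia.
  transitivity ((-1) ^+ (3 * j) * \prod_(0 <= i < 3 * j) (- p%:Z + i.+1%:R)).
    rewrite -[X in _ ^+ X]subn0 -prodr_const_nat -big_split.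
    by apply: eq_bigr => i _ /=; rewrite natz mulN1r opprD opprK.
  rewrite (prod_residues _ _ _ _ he) !big_split /=.
  rewrite exprM (_ : (-1) ^+ 3 = -1) // /b.
  have -> : \prod_(0 <= i < j) ((3 - e)%N%:Z - p%:Z + 3 *+ i) =
      \prod_(0 <= i < j) (- p%:Z + (3 * i + (3 - e))%N%:R).
    by apply: eq_bigr => i _; rewrite natz; lia.
  have -> : \prod_(0 <= i < j) ((3 * i.+1)%N%:Z - p%:Z) =
      \prod_(0 <= i < j) (- p%:Z + (3 * i.+1)%N%:R).
    by apply: eq_bigr => i _; rewrite natz; lia.
  have -> : \prod_(0 <= i < j) (- p%:Z + (3 * i + e)%N%:Z) =
      \prod_(0 <= i < j) (- p%:Z + (3 * i + e)%N%:R).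
    by apply: eq_bigr => i _; rewrite natz.
  by rewrite -[X in _ = _ * X]mulrA [RHS]mulrCA !mulrA.
have sgn2 : (-1) ^+ j * (-1) ^+ j = 1 :> int by rewrite -expr2 sqrr_sign.
transitivity ((p%:Z * (3 ^+ (p - 3 * j) * (-3) ^+ j * 'C(n, j)%:R * j`!%:Z *
   \prod_(0 <= i < j) (b + 3 *+ i) *
   \prod_(0 <= i < j) ((p%:Z + i.+1%:Z) * ((3 * i.+1)%N%:Z - p%:Z) * (c + 3 *+ i)))) %% p%:Z ^+ 3)%Z.
  congr (_ %% _)%Z; rewrite split !big_split /=.
  rewrite -[RHS]mul1r -[X in _ = X * _]sgn2.
  move: (\prod_(_ <= _ < _) _) => P1; move: (\prod_(_ <= _ < _) _) => P2.
  move: (\prod_(_ <= _ < _) _) => P3; move: (\prod_(_ <= _ < _) _) => P4.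
  ring.
transitivity ((p%:Z * (3 ^+ (p - 3 * j) * (-3) ^+ j * 'C(n, j)%:R * j`!%:Z *
   \prod_(0 <= i < j) (b + 3 *+ i) *
   \prod_(0 <= i < j) (9 * i.+1%:Z ^+ 3))) %% p%:Z ^+ 3)%Z.
  apply: eqz_mod_lift; apply: eqz_modM => //; apply: eqz_mod_prod => i _.
  apply/eqz_modP/dvdzP; exists (2 * p%:Z - 7 * i.+1%:Z).
  rewrite (_ : c + 3 *+ i = 3 * i.+1%:Z - 2 * p%:Z); last by rewrite /c; lia.
  by rewrite PoszM; ring.
congr (_ %% _)%Z.
have -> : \prod_(0 <= i < j) (9 * i.+1%:Z ^+ 3) = 9 ^+ j * j`!%:Z ^+ 3.
  rewrite big_split /= prodr_const_nat subn0 prodrXl fact_prod big_add1 /=.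
  by congr (_ * _ ^+ 3); rewrite -[RHS]natz natr_prod; apply: eq_bigr => i _; rewrite natz.
have -> : 3 ^+ p = 3 ^+ (p - 3 * j) * (3 ^+ j * 9 ^+ j) :> int.
  by rewrite -exprMn (_ : 3 * 9 = 3 ^+ 3 :> int) // -exprM -exprD subnK // ltnW.
rewrite exprNn; ring.
Qed.

Lemma sum_AZ_prime : (\sum_(0 <= k < p) (4 * k + 3)%N%:Z * AZ k =
   3 * (-1) ^+ n * p%:Z %[mod p%:Z ^+ 3])%Z.
Proof.
pose P := \prod_(0 <= i < n) (c + 3 *+ i).
have PE : P = \prod_(0 <= i < n) ((3 * i.+1)%N%:Z - 2 * p%:Z).
  by apply: eq_bigr => i _; rewrite /c; lia.
have coP : coprimez (p%:Z ^+ 3) P.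
  rewrite PE coprimezXl // coprimez_prod // => i ip.
  by rewrite coprimez_shift //; case/orP: he; lia.
apply: (eqz_mod_mul2l _ _ _ _ coP).
have -> : \sum_(0 <= k < p) (4 * k + 3)%N%:Z * AZ k =
    \sum_(0 <= j < n.+1) - ((p - 3 * j)%N%:Z * AZ_term p j).
  rewrite sum_AZ (@big_cat_nat _ _ _ n.+1) //=; last by case/orP: he; lia.
  rewrite [X in _ + X]big_nat_cond [X in _ + X]big1 ?addr0 ?sumrN // => j.
  rewrite andbT => /andP[lt_nj _]; rewrite AZ_term_small ?mulr0 //.
  by case/orP: he; lia.
have sum_mod : (P * (\sum_(0 <= j < n.+1) - ((p - 3 * j)%N%:Z * AZ_term p j)) =
    3 ^+ p * p%:Z * \sum_(0 <= j < n.+1)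
      ((-1) ^+ j * 'C(n, j)%:R * \prod_(0 <= i < j) (b + 3 *+ i) * \prod_(j <= i < n) (c + 3 *+ i))
    %[mod p%:Z ^+ 3])%Z.
  apply/eqz_modP; rewrite !mulr_sumr -sumrB big_nat; apply: rpred_sum => j /andP[_ le_jn].
  apply/eqz_modP.
  (* The factors of [P] below [j] are absorbed by the term; those from [j] on are the tail in
     Chu-Vandermonde. *)
  rewrite /P (@big_cat_nat _ _ _ j) //= mulrAC [X in (_ = X %[mod _])%Z]mulrA.
  by apply: eqz_modM => //; apply: AZ_term_mod.
rewrite {}sum_mod chu_vandermonde.
have -> : \prod_(0 <= i < n) (c - b + 3 *+ i) = (-1) ^+ n * \prod_(0 <= i < n) (3 * i.+1)%N%:Z.
  rewrite -[X in _ ^+ X]subn0 -prodr_const_nat -big_split big_nat_rev big_nat [RHS]big_nat.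
  by apply: eq_bigr => i ip /=; rewrite /c /b; case/orP: he; lia.
transitivity ((p%:Z * (3 * (-1) ^+ n * (3 ^+ p.-1 * \prod_(0 <= i < n) (3 * i.+1)%N%:Z))) %% p%:Z ^+ 3)%Z.
  have -> : 3 ^+ p = 3 * 3 ^+ p.-1 :> int by rewrite -exprS prednK //; lia.
  by congr (_ %% _)%Z; ring.
(* The power of 3 and the product of the 3i recombine into [P], the unit multiplied in at the
   start. *)
transitivity ((p%:Z * (3 * (-1) ^+ n * P)) %% p%:Z ^+ 3)%Z.
  by apply: eqz_mod_lift; apply: eqz_modM => //; rewrite PE; apply: (@pow3_prod p n e).
by congr (_ %% _)%Z; ring.
Qed.

End Congruence.

Theorem theorem1p2 (p : nat) (p_prime : prime p) (p_ge5 : (5 <= p)%N) :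
  (\sum_(0 <= k < p) (4 * k + 3)%N%:Z * AZ k
     = 3 * legendre (-3) p * p%:Z %[mod (p ^ 3)%N%:Z])%Z.
Proof.
have pE : p = (3 * (p %/ 3) + p %% 3)%N by lia.
have he : (p %% 3 == 1)%N || (p %% 3 == 2)%N.
  have : ~~ (3 %| p)%N by rewrite dvdn_prime2 //; lia.
  by rewrite /dvdn; lia.
have -> : (p ^ 3)%N%:Z = p%:Z ^+ 3 by rewrite -natz natrX natz.
rewrite (sum_AZ_prime _ _ _ p_prime p_ge5 pE he) legendreN3 //.
have p_odd : odd p by have [|] := even_prime p_prime; [lia|].
congr (_ * _ * _ %% _)%Z; rewrite -signr_odd.
(* As p is odd, n is even when p = 3n + 1 and odd when p = 3n + 2. *)
case: ifP => p1; [rewrite (_ : odd _ = false) //|rewrite (_ : odd _ = true) //]; lia.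
Qed.
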